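(* Let $\alpha>0$ and $(a,b)\in\mathbb{R}^2$ with $a<b$. If $f\in AC([a,b];\mathbb{R})$, then $\mathcal{D}_a^\alpha f$ exists almost everywhere in $[a,b]$, and can be represented in the form $$\left(\mathcal{D}_a^\alpha f\right)(x)=f(a)\left[\frac{1}{\alpha}E_1\left(\frac{x-a}{\alpha}\right)\right]+\int_a^x \frac{1}{\alpha}E_1\left(\frac{x-y}{\alpha}\right)\frac{df}{dy}(y)\,dy,\quad \text{for a.e. } x\in[a,b].$$
   Context: $AC([a,b];\mathbb{R})$ is the space of real-valued absolutely continuous functions on $[a,b]$. Let $E_1(x)=\int_x^\infty \frac{e^{-t}}{t}\,dt$ for $x>0$. For $\alpha>0$ and $f\in L^1([a,b];\mathbb{R})$, let $$(J_a^\alpha f)(x)=\frac{1}{\alpha}\int_a^x E_1\left(\frac{x-t}{\alpha}\right)f(t)\,dt\quad\text{for a.e. } x\in[a,b].$$ A function in $L^1([a,b];\mathbb{R})$ has an absolutely continuous representative if it coincides a.e. on $[a,b]$ with a function in $AC([a,b];\mathbb{R})$; it is then identified with that function. If $J_a^\alpha f$ has an absolutely continuous representative, the left-sided fractional derivative of order $\alpha$ of $f$ is $(\mathcal{D}_a^\alpha f)(x)=\frac{d}{dx}(J_a^\alpha f)(x)$ for a.e. $x\in[a,b]$. *)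

(* Defs.v *)
From HB Require Import structures.
From mathcomp Require Import all_boot all_order all_algebra.
From mathcomp Require Import all_classical all_reals all_analysis.
Set Implicit Arguments.
Unset Strict Implicit.
Unset Printing Implicit Defensive.
Import Order.TTheory GRing.Theory Num.Theory.
Import numFieldNormedType.Exports.
Local Open Scope classical_set_scope.
Local Open Scope ring_scope.

(* A function on [a, b] is a function R -> R of which only the values on
   [a, b] are meant. *)

(* AC([a, b]; R): the epsilon-delta definition, over finite families of
   pairwise disjoint open subintervals (possibly empty) of [a, b]. *)
Definition abs_continuous (R : realType) (a b : R) (f : R -> R) : Prop :=
  forall e : R, 0 < e -> exists2 d : R, 0 < d &
    forall (n : nat) (u v : 'I_n -> R),
      (forall i, a <= u i /\ u i <= v i /\ v i <= b) ->
      trivIset [set: 'I_n] (fun i => `]u i, v i[%classic) ->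
      \sum_(i < n) (v i - u i) < d ->
      \sum_(i < n) `|f (v i) - f (u i)| < e.

(* Meaningful for 0 < x only; at x <= 0 the integral diverges and the value
   is arbitrary. Below, the argument 0 is met only on Lebesgue-null sets. *)
Definition E1 (R : realType) (x : R) : R :=
  \int[@lebesgue_measure R]_(t in `[x, +oo[) (expR (- t) / t).

Definition frac_int (R : realType) (alpha a : R) (f : R -> R) (x : R) : R :=
  alpha^-1 *
  \int[@lebesgue_measure R]_(t in `[a, x]) (E1 ((x - t) / alpha) * f t).

Definition is_AC_rep (R : realType) (a b : R) (g F : R -> R) : Prop :=
  abs_continuous a b F /\
  {ae @lebesgue_measure R, forall x, x \in `[a, b] -> g x = F x}.

(* Absolutely continuous representatives agree on [a, b]; choosing one only
   leaves the values outside [a, b] unspecified. *)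
Definition AC_rep (R : realType) (a b : R) (g : R -> R) : R -> R :=
  xget g [set F | is_AC_rep a b g F].

Definition frac_deriv (R : realType) (alpha a b : R) (f : R -> R) : R -> R :=
  derive1 (AC_rep a b (frac_int alpha a f)).

(* derive1 is total, with an arbitrary value where the limit does not exist,
   so the existence of the derivative has to be stated separately. *)
Definition frac_deriv_exists_ae (R : realType) (alpha a b : R) (f : R -> R)
    : Prop :=
  [/\ (@lebesgue_measure R).-integrable `[a, b] (EFin \o f),
      exists F, is_AC_rep a b (frac_int alpha a f) F &
      {ae @lebesgue_measure R, forall x, x \in `[a, b] ->
         derivable (AC_rep a b (frac_int alpha a f)) x 1}].

(* Main.v *)
Require Import Defs.
From HB Require Import structures.
From mathcomp Require Import all_boot all_order all_algebra.
From mathcomp Require Import all_classical all_reals all_analysis.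
From mathcomp Require Import measurable_realfun ring lra.
Set Implicit Arguments.
Unset Strict Implicit.
Unset Printing Implicit Defensive.
Import Order.TTheory GRing.Theory Num.Theory.
Import numFieldNormedType.Exports.
Local Open Scope classical_set_scope.
Local Open Scope ring_scope.

(* Write f(x) = f(a) + int_a^x g with g integrable and g = f' almost
   everywhere, and let k(s) = E1(s / alpha) / alpha for s > 0, k(s) = 0
   otherwise, which is integrable by Tonelli. Exchanging the order of
   integration,
     (J f)(x) = int_a^x k(x - t) f(t) dt
              = int_a^x (f(a) k(y - a) + (k * g)(y)) dy,
   so J f is the primitive of an integrable function: it is absolutely
   continuous, and Lebesgue differentiation gives its derivative.
   The density g is a Radon-Nikodym derivative: the total variation V of f and
   V - f are nondecreasing and absolutely continuous, hence their
   Lebesgue-Stieltjes measures are dominated by the Lebesgue measure. *)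

(** * Absolute continuity and total variation *)

(** Lebesgue measure is taken on the Borel sets, which are not complete: that [derive1 f] agrees
    almost everywhere with the density does not make the integrand of the theorem measurable.
    Measurability of the derivative of a continuous function is therefore proved separately. The
    other obstacle is arbitrary values: [E1] at 0, and both [f] and the chosen representative
    outside [[a, b]]. This is the reason for composing with the projection onto [[a, b]], for
    dropping endpoints of intervals, and for differentiating at interior points only. *)

Definition disjoint_ooitv (R : realType) (p q : R * R) : bool :=
  `[< `]p.1, p.2[ `&` `]q.1, q.2[ = set0 >].

Definition subitv (R : realType) (a b : R) (p : R * R) : bool :=
  [&& a <= p.1, p.1 <= p.2 & p.2 <= b].

Lemma disjoint_ooitvC (R : realType) (p q : R * R) :
  disjoint_ooitv p q = disjoint_ooitv q p.
Proof. by rewrite /disjoint_ooitv setIC. Qed.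

Lemma disjoint_ooitvS (R : realType) (p q : R * R) (q' : R * R) :
  q.1 <= q'.1 -> q'.2 <= q.2 -> disjoint_ooitv p q -> disjoint_ooitv p q'.
Proof.
move=> q1 q2 /asboolP pq; apply/asboolP; rewrite -subset0 -pq.
apply: setIS => x /=; rewrite !in_itv/= => /andP[q1x xq2].
by rewrite (le_lt_trans q1)//= (lt_le_trans xq2).
Qed.

(** Sequences replace families indexed by ['I_n] because refining a family of intervals by induction
    changes its cardinality. *)
Lemma abs_continuous_seq (R : realType) (a b : R) (f : R -> R) (e : R) :
  abs_continuous a b f -> 0 < e -> exists2 d : R, 0 < d &
    forall s : seq (R * R), all (subitv a b) s -> pairwise (@disjoint_ooitv R) s ->
      \sum_(p <- s) (p.2 - p.1) < d -> \sum_(p <- s) `|f p.2 - f p.1| < e.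
Proof.
move=> /[apply] -[d d0 fd]; exists d => // s /all_nthP sab /(pairwiseP (0, 0)) ds.
rewrite !(big_nth (0, 0)) !big_mkord => sd.
apply: (fd _ (fun i => (nth (0, 0) s i).1) (fun i => (nth (0, 0) s i).2)) => //.
- by move=> i; have /and3P[] := sab (0, 0) _ (ltn_ord i).
- apply/trivIsetP => i j _ _ ij.
  have [lij|lji] : (i < j)%N \/ (j < i)%N.
    by apply/orP; rewrite -neq_ltn; exact: ij.
  + by have /asboolP := ds _ _ (ltn_ord i) (ltn_ord j) lij.
  + have /asboolP := ds _ _ (ltn_ord j) (ltn_ord i) lji.
    by rewrite setIC.
Qed.

Fixpoint itv_pairs (R : realType) (a : R) (s : seq R) : seq (R * R) :=
  if s is x :: s' then (a, x) :: itv_pairs x s' else [::].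

Lemma itv_pairs_subitv (R : realType) (a b : R) (s : seq R) :
  itv_partition a b s -> all (subitv a b) (itv_pairs a s).
Proof.
elim: s a => //= x s ih a abxs.
have ax : a <= x by case: abxs => /= /andP[/ltW].
have xb := itv_partition_le (itv_partition_cons abxs).
rewrite /subitv /= lexx ax xb/=.
apply: sub_all (ih _ (itv_partition_cons abxs)) => -[u v] /and3P[/= xu uv vb].
by rewrite /= (le_trans ax xu) uv vb.
Qed.

Lemma itv_pairs_disjoint (R : realType) (a b : R) (s : seq R) :
  itv_partition a b s -> pairwise (@disjoint_ooitv R) (itv_pairs a s).
Proof.
elim: s a => //= x s ih a abxs; rewrite ih ?andbT; last first.
  exact: itv_partition_cons abxs.
apply: sub_all (itv_pairs_subitv (itv_partition_cons abxs)) => -[u v].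
move=> /and3P[/= xu uv vb]; apply/asboolP; rewrite -subset0 => z /=.
rewrite !in_itv/= => -[/andP[az zx] /andP[uz zv]].
by have := lt_trans zx (le_lt_trans xu uz); rewrite ltxx.
Qed.

Lemma itv_pairs_length (R : realType) (a b : R) (s : seq R) :
  itv_partition a b s -> \sum_(p <- itv_pairs a s) (p.2 - p.1) = b - a.
Proof.
elim: s a => [a /itv_partition_nil ->|x s ih a abxs] /=.
  by rewrite big_nil subrr.
by rewrite big_cons (ih _ (itv_partition_cons abxs))/= addrC subrKA.
Qed.

Lemma itv_pairs_variation (R : realType) (a b : R) (f : R -> R) (s : seq R) :
  variation a b f s = \sum_(p <- itv_pairs a s) `|f p.2 - f p.1|.
Proof.
elim: s a => [a|x s ih a] /=; first by rewrite variation_nil big_nil.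
rewrite big_cons -ih /variation /= big_nat_recl//=.
Qed.

Lemma pairwise_disjoint_refine (R : realType) (p : R * R) (s t : seq (R * R)) :
  all (subitv p.1 p.2) t -> pairwise (@disjoint_ooitv R) t ->
  pairwise (@disjoint_ooitv R) (p :: s) -> pairwise (@disjoint_ooitv R) (s ++ t).
Proof.
move=> tp dt; rewrite pairwise_cat /= dt andbT => /andP[/allP ps ->].
rewrite andbT; apply/allrelP => q r qs /(allP tp)/and3P[pr _ rp].
by apply: disjoint_ooitvS pr rp _; rewrite disjoint_ooitvC ps.
Qed.

(* The intervals of [s] are replaced one at a time by finite partitions, whose
   members accumulate in [t]. *)
Lemma sum_total_variation_le (R : realType) (a b : R) (f : R -> R) (d e : R)
    (s t : seq (R * R)) :
  (forall s : seq (R * R), all (subitv a b) s ->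
    pairwise (@disjoint_ooitv R) s ->
    \sum_(p <- s) (p.2 - p.1) < d -> \sum_(p <- s) `|f p.2 - f p.1| <= e) ->
  all (subitv a b) (s ++ t) -> pairwise (@disjoint_ooitv R) (s ++ t) ->
  \sum_(p <- s ++ t) (p.2 - p.1) < d ->
  (\sum_(p <- s) total_variation p.1 p.2 f +
    (\sum_(p <- t) `|f p.2 - f p.1|)%:E <= e%:E)%E.
Proof.
move=> fde; elim: s t => [t at_ dt ld|p s ih t] /=.
  by rewrite big_nil add0e lee_fin; exact: fde.
move=> /andP[/and3P[ap pp pb] ast] dst lst.
have lenst : \sum_(q <- s ++ t) (q.2 - q.1) < d.
  apply: le_lt_trans lst; rewrite [leRHS]big_cons lerDr subr_ge0//.
have Xe : (\sum_(p <- s) total_variation p.1 p.2 f +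
    (\sum_(p <- t) `|f p.2 - f p.1|)%:E <= e%:E)%E.
  by apply: ih => //; move: dst => /andP[].
have X0 : (0 <= \sum_(p <- s) total_variation p.1 p.2 f +
    (\sum_(p <- t) `|f p.2 - f p.1|)%:E)%E.
  rewrite adde_ge0//; last by rewrite lee_fin sumr_ge0.
  rewrite big_seq sume_ge0// => q qs; apply: total_variation_ge0.
  by have /allP/(_ q) := ast; rewrite mem_cat qs => /(_ isT)/and3P[].
have Xfin : (\sum_(p <- s) total_variation p.1 p.2 f +
    (\sum_(p <- t) `|f p.2 - f p.1|)%:E)%E \is a fin_num.
  by rewrite ge0_fin_numE// (le_lt_trans Xe)// ltry.
(* The rest of the sum is finite, so it can be moved to the other side; the supremum that defines
   the total variation over [p] is then bounded partition by partition. *)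
rewrite big_cons -addeA -leeBrDr//; apply: ge_ereal_sup => _ [_ [w wP <-] <-].
rewrite leeBrDr// addeCA itv_pairs_variation -EFinD [X in X%:E]addrC -big_cat/=.
have wa := itv_pairs_subitv wP.
apply: ih.
- rewrite catA all_cat ast/=; apply: sub_all wa => q /and3P[pq qq qp].
  by rewrite /subitv (le_trans ap)//= qq (le_trans qp).
- by rewrite catA; apply: pairwise_disjoint_refine wa (itv_pairs_disjoint wP) _.
- rewrite catA big_cat /= (itv_pairs_length wP).
  by move: lst; rewrite big_cons addrC.
Qed.

(** For the [d] attached to e = 1, an interval shorter than [d] has total variation at most 1, and
    [[a, b]] splits into finitely many such intervals of equal length [h]. *)
Lemma abs_continuous_bounded_variation (R : realType) (a b : R) (f : R -> R) :
  a < b -> abs_continuous a b f -> bounded_variation a b f.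
Proof.
move=> ab /abs_continuous_seq /(_ ltr01)[d d0 fd].
have TV1 x y : a <= x -> x <= y -> y <= b -> y - x < d ->
    (total_variation x y f <= 1%:E)%E.
  move=> ax xy yb yxd.
  have := @sum_total_variation_le _ a b f d 1 [:: (x, y)] [::].
  rewrite !big_cons !big_nil/= adde0 adde0; apply.
  - by move=> s sab ds sd; exact/ltW/fd.
  - by rewrite /subitv/= ax xy yb.
  - by [].
  - by rewrite addr0.
have [n nd] : exists n : nat, (b - a) / n.+1%:R < d.
  exists (Num.truncn ((b - a) / d)); rewrite ltr_pdivrMr// mulrC -ltr_pdivrMr//.
  by rewrite truncnS_gt.
pose h := (b - a) / n.+1%:R.
have h0 : 0 < h by rewrite divr_gt0// subr_gt0.
have hn : h * n.+1%:R = b - a by rewrite /h divfK.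
have TVk k : (k <= n.+1)%N -> (total_variation a (a + h * k%:R) f < +oo)%E.
  elim: k => [_|k ih kn]; first by rewrite mulr0 addr0 total_variationxx ltry.
  have kb : a + h * k.+1%:R <= b.
    by rewrite -lerBrDl -hn ler_pM2l// ler_nat.
  have ka : a <= a + h * k%:R by rewrite lerDl mulr_ge0// ltW.
  have kk : a + h * k%:R <= a + h * k.+1%:R by rewrite lerD2l ler_pM2l// ler_nat.
  rewrite (total_variationD _ ka kk) lte_add_pinfty//; first exact/ih/ltnW.
  apply: le_lt_trans (ltry 1); apply: TV1 => //.
  rewrite (_ : _ - _ = h)// -natr1; ring.
apply/bounded_variationP; first exact: ltW.
rewrite ge0_fin_numE ?total_variation_ge0 ?ltW//.
by have := TVk _ (leqnn n.+1); rewrite hn addrC subrK.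
Qed.

(** Projection of the line onto [[a, b]]. Composing with it extends a function by its end values, as
    Stieltjes measures and two-sided continuity call for functions on the whole line. *)
Definition clamp (R : realType) (a b x : R) : R := Num.max a (Num.min b x).

Lemma clamp_ge (R : realType) (a b x : R) : a <= clamp a b x.
Proof. by rewrite le_max lexx. Qed.

Lemma clamp_le (R : realType) (a b x : R) : a <= b -> clamp a b x <= b.
Proof. by move=> ab; rewrite ge_max ab ge_min lexx. Qed.

Lemma clamp_id (R : realType) (a b x : R) : a <= x -> x <= b -> clamp a b x = x.
Proof. by move=> ax xb; rewrite /clamp min_r// max_r. Qed.

Lemma clamp_homo (R : realType) (a b x y : R) :
  x <= y -> clamp a b x <= clamp a b y.
Proof.
move=> xy; rewrite /clamp ge_max le_max lexx/= le_max; apply/orP; right.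
by rewrite le_min !ge_min lexx xy orbT.
Qed.

Lemma clamp_lip (R : realType) (a b x y : R) : a <= b ->
  x <= y -> clamp a b y - clamp a b x <= y - x.
Proof.
move=> ab xy; rewrite /clamp !maxEle !minEle.
by case: (leP b y) => ?; case: (leP b x) => ?; case: (leP a y) => ?;
  case: (leP a x) => ?; case: (leP a b) => ?; lra.
Qed.

Lemma clamp_oo (R : realType) (a b x y z : R) : a <= b ->
  clamp a b x < z < clamp a b y -> x < z < y.
Proof.
move=> ab; rewrite /clamp !maxEle !minEle.
by case: (leP b y) => ?; case: (leP b x) => ?; case: (leP a y) => ?;
  case: (leP a x) => ?; case: (leP a b) => ?; lra.
Qed.

(** The projection is nondecreasing and 1-Lipschitz, so it carries disjoint intervals to disjoint
    intervals that are no longer. *)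
Lemma abs_continuous_clamp (R : realType) (a b c d : R) (f : R -> R) :
  a <= b -> abs_continuous a b f -> abs_continuous c d (f \o clamp a b).
Proof.
move=> ab fab e e0; have [r r0 fr] := fab _ e0; exists r => // n u v uv tuv luv.
apply: (fr _ (clamp a b \o u) (clamp a b \o v)).
- move=> i; have [_ [uvi _]] := uv i.
  by rewrite /= clamp_ge clamp_le// clamp_homo.
- apply/trivIsetP => i j _ _ ij; have /trivIsetP/(_ i j I I ij) := tuv.
  apply: subsetI_eq0 => z /=; rewrite !in_itv/=; exact: clamp_oo.
- apply: le_lt_trans luv; apply: ler_sum => i _; apply: clamp_lip => //.
  by have [_ []] := uv i.
Qed.

Lemma abs_continuousB (R : realType) (a b : R) (f g : R -> R) :
  abs_continuous a b f -> abs_continuous a b g -> abs_continuous a b (f \- g).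
Proof.
move=> fac gac e e0; have e20 : 0 < e / 2 by rewrite divr_gt0.
have [r r0 fr] := fac _ e20; have [s s0 gs] := gac _ e20.
exists (Num.min r s) => [|n u v uv tuv]; first by rewrite lt_min r0.
rewrite lt_min => /andP[luvr luvs].
have := ltrD (fr _ _ _ uv tuv luvr) (gs _ _ _ uv tuv luvs).
rewrite -splitr; apply: le_lt_trans; rewrite -big_split/=; apply: ler_sum => i _.
rewrite /= (_ : f (v i) - g (v i) - (f (u i) - g (u i)) =
  f (v i) - f (u i) - (g (v i) - g (u i))); last by ring.
exact: ler_normB.
Qed.

(** An increment of the variation function is the total variation over that interval, so the bound
    on sums of total variations applies. Passing to suprema loses strictness, hence [e / 2]. *)
Lemma abs_continuous_total_variation (R : realType) (a b : R) (f : R -> R) :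
  a < b -> abs_continuous a b f ->
  abs_continuous a b (fun x => fine (total_variation a x f)).
Proof.
move=> ab fac e e0; have e20 : 0 < e / 2 by rewrite divr_gt0.
have BVf := abs_continuous_bounded_variation ab fac.
have [d d0 fd] := abs_continuous_seq fac e20; exists d => // n u v uv tuv luv.
have TVfin i : total_variation (u i) (v i) f \is a fin_num.
  have [au [uv' vb]] := uv i; apply/bounded_variationP => //.
  apply: (bounded_variationr au uv'); apply: bounded_variationl BVf => //.
  exact: le_trans uv'.
have TVE i : `|fine (total_variation a (v i) f) - fine (total_variation a (u i) f)|
    = fine (total_variation (u i) (v i) f).
  have [au [uv' vb]] := uv i; rewrite (total_variationD _ au uv') fineD//.
    by rewrite addrAC subrr add0r ger0_norm// fine_ge0// total_variation_ge0.
  apply/bounded_variationP => //; apply: bounded_variationl BVf => //.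
  exact: le_trans vb.
under eq_bigr do rewrite TVE.
pose s := [seq (u i, v i) | i <- index_enum 'I_n].
have := @sum_total_variation_le _ a b f d (e / 2) s [::].
rewrite cats0 big_nil adde0 /s !big_map/= => TVe.
rewrite -lte_fin -sumEFin; under eq_bigr do rewrite fineK//.
apply: (@le_lt_trans _ _ (e / 2)%:E); last by rewrite lte_fin; lra.
apply: TVe => //.
- by move=> w wab dw lw; exact/ltW/fd.
- by rewrite all_map; apply/allP => i _ /=; rewrite /subitv/=; have [-> [-> ->]] := uv i.
- rewrite pairwise_map; have := index_enum_uniq 'I_n; rewrite uniq_pairwise.
  apply: sub_pairwise => i j /= ij; apply/asboolP.
  by have /trivIsetP/(_ i j I I ij) := tuv.
Qed.

(** * Absolutely continuous functions are primitives *)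

Lemma abs_continuous_dist (R : realType) (a b : R) (f : R -> R) (e : R) :
  abs_continuous a b f -> 0 < e -> exists2 d : R, 0 < d &
    forall x y, a <= x <= b -> a <= y <= b -> `|x - y| < d -> `|f x - f y| < e.
Proof.
move=> /abs_continuous_seq /[apply] -[d d0 fd]; exists d => // x y.
wlog xy : x y / y <= x.
  move=> wlg xab yab; have [yx|xy] := leP y x; first exact: wlg.
  by rewrite distrC [X in _ -> X < _]distrC; apply: wlg => //; exact: ltW.
move=> /andP[ax xb] /andP[ay yb]; rewrite ger0_norm ?subr_ge0// => xyd.
have := fd [:: (y, x)]; rewrite !big_cons !big_nil/= !addr0; apply=> //.
by rewrite /subitv/= ay xy xb.
Qed.

Lemma abs_continuous_clamp_continuous (R : realType) (a b : R) (f : R -> R) :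
  a <= b -> abs_continuous a b f -> continuous (f \o clamp a b).
Proof.
move=> ab fac x; apply/cvgrPdist_lt => e e0.
have [d d0 fd] := abs_continuous_dist (abs_continuous_clamp (x - 1) (x + 1) ab fac) e0.
near=> y; apply: fd.
- by lra.
- rewrite -ler_distlC; near: y; apply/nbhs_ballP; exists 1 => //= z.
  by rewrite /ball/= distrC => /ltW.
- by near: y; apply/nbhs_ballP; exists d => //= z.
Unshelve. all: by end_near. Qed.

Section monotone.
Variables (R : realType) (a b : R) (G : R -> R).
Hypotheses (ab : a <= b) (Gac : abs_continuous a b G)
  (Gnd : {in `[a, b] &, nondecreasing_fun G}).

Let Gc := G \o clamp a b.

Let Gc_nd : nondecreasing Gc.
Proof.
move=> x y xy; apply: Gnd; rewrite ?in_itv/= ?clamp_ge ?clamp_le//.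
exact: clamp_homo.
Qed.

Let Gc_rc (x : R) : Gc @ x^'+ --> Gc x.
Proof. exact/right_continuousW/abs_continuous_clamp_continuous. Qed.

HB.instance Definition _ := isCumulative.Build R _ R Gc Gc_nd Gc_rc.

Let nu := lebesgue_stieltjes_measure Gc.

Let nu_oc (u v : R) : u <= v -> nu `]u, v]%classic = (Gc v - Gc u)%:E.
Proof.
move=> uv; rewrite /nu /lebesgue_stieltjes_measure /measure_extension.
by rewrite measurable_mu_extE/=; [rewrite wlength_itv_bnd|exact: is_ocitv].
Qed.

(* A null set is covered by an open set of small measure, whose components are
   disjoint intervals of small total length. *)
Let nu_null (A : set R) : measurable A -> A `<=` `]a - 1, b + 1[ ->
  lebesgue_measure A = 0%E -> nu A = 0%E.
Proof.
move=> mA Aab A0; have [a1a ab1] : a - 1 <= a /\ a <= b + 1.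
  by rewrite gerBl ler01 (le_trans ab)// lerDl ler01.
apply/eqP; rewrite eq_le measure_ge0 andbT.
suff nuA_le (e : R) : 0 < e -> (nu A <= e%:E)%E.
  by apply/lee_addgt0Pr => e e0; rewrite add0e; exact: nuA_le.
move=> e0.
have [d d0 Gd] := abs_continuous_clamp (a - 1) (b + 1) ab Gac e0.
have Aoo : (lebesgue_measure A < +oo)%E by rewrite A0 ltry.
have [U [oU AU UAd]] := lebesgue_regularity_outer mA Aoo d0.
(* The intersection makes the components bounded and keeps them where the absolute continuity of
   [Gc] was instantiated. *)
pose O := U `&` `]a - 1, b + 1[.
have oO : open O by apply: openI => //; exact: itv_open.
have AO : A `<=` O by rewrite subsetI; split.
have Od : (lebesgue_measure O < d%:E)%E.
  apply: le_lt_trans UAd; rewrite [leRHS](_ : _ = lebesgue_measure U).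
    by apply: le_measure; rewrite ?inE//; [exact: open_measurable..|exact: subIsetl].
  rewrite -[in RHS](setDKU AU) measureU//=; last 2 first.
  - by apply: measurableD => //; exact: open_measurable.
  - by rewrite setDE -setIA setICl setI0.
  by rewrite [X in (_ + X)%E]A0 adde0.
pose C := open_disjoint_itv oO.
have Csub i : C i `<=` `]a - 1, b + 1[.
  move=> x Cix; suff : O x by move=> [].
  by rewrite (open_disjoint_itv_bigcup oO); exists i.
(* A component may be empty; it is then written as the degenerate interval []a, a[], since [inf] and
   [sup] carry no information there. *)
pose u i := if pselect (C i = set0) then a else inf (C i).
pose v i := if pselect (C i = set0) then a else sup (C i).
have CE i : C i = `]u i, v i[%classic.
  rewrite /u /v; case: pselect => [/= C0|/= C0]; first by rewrite set_itvoo0.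
  rewrite -[LHS](interior_id _).1; last exact: open_disjoint_itv_open.
  rewrite interval_bounded_interior//.
  - exact: open_disjoint_itv_is_interval.
  - by exists (a - 1) => x /Csub/=; rewrite in_itv/= => /andP[/ltW].
  - by exists (b + 1) => x /Csub/=; rewrite in_itv/= => /andP[_ /ltW].
have uv i : [/\ a - 1 <= u i, u i <= v i & v i <= b + 1].
  have [C0|/set0P[z Ciz]] := eqVneq (C i) set0.
    by rewrite /u /v; case: pselect => //= _; split.
  have uzv : u i < z < v i by move: Ciz; rewrite CE /= in_itv.
  have CN0 : C i <> set0 by move=> C0; move: Ciz; rewrite C0.
  rewrite /u /v in uzv *; case: pselect uzv => //= _ uzv; split.
  - apply: lb_le_inf; first by exists z.
    by move=> x /Csub/=; rewrite in_itv/= => /andP[/ltW].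
  - by have /andP[/ltW + /ltW] := uzv; exact: le_trans.
  - apply: ge_sup; first by exists z.
    by move=> x /Csub/=; rewrite in_itv/= => /andP[_ /ltW].
have mC i : measurable (C i) by rewrite CE; exact: measurable_itv.
have tC : trivIset setT C by exact: open_disjoint_itv_trivIset.
have OE (m : {measure set (measurableTypeR R) -> \bar R}) :
    m O = (\sum_(0 <= i <oo) m (C i))%E.
  rewrite (open_disjoint_itv_bigcup oO) measure_bigcup//; last by move=> i _; exact: mC.
  by apply: eq_eseriesl => i; rewrite in_setT.
apply: (@le_trans _ _ (nu O)).
  by apply: le_measure; rewrite ?inE//; exact: open_measurable.
rewrite [leLHS](OE nu); apply: lime_le; first exact: is_cvg_nneseries.
(* Absolute continuity speaks of finite families, so partial sums are bounded. Each open component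
   is enlarged to []u i, v i]], whose measure is the increment of [Gc]. *)
near=> n; rewrite big_mkord.
apply: (@le_trans _ _ (\sum_(i < n) (Gc (v i) - Gc (u i))%:E)%E).
  apply: lee_sum => i _; have [_ uvi _] := uv i; rewrite -nu_oc//.
  apply: le_measure.
  - by rewrite inE; exact: mC.
  - by rewrite inE; exact: measurable_itv.
  by rewrite CE; apply: subset_itvW => //; rewrite bnd_simp.
rewrite sumEFin lee_fin; apply/ltW.
apply: (@le_lt_trans _ _ (\sum_(i < n) `|Gc (v i) - Gc (u i)|)).
  by apply: ler_sum => i _; exact: ler_norm.
apply: (Gd n (fun i => u i) (fun i => v i)).
- by move=> i; have [] := uv i.
- apply/trivIsetP => i j _ _ ij; rewrite -!CE.
  by have /trivIsetP/(_ i j I I ij) := tC.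
- rewrite -lte_fin -sumEFin; apply: le_lt_trans Od; rewrite [leRHS](OE lebesgue_measure).
  apply: le_trans; last exact: (nneseries_lim_ge n).
  rewrite big_mkord; apply: lee_sum => i _.
  have [_ uvi _] := uv i.
  rewrite [X in (_ <= lebesgue_measure X)%E]CE lebesgue_measure_itv/= lte_fin.
  case: ltP => // vu; rewrite lee_fin; lra.
Unshelve. all: by end_near. Qed.

(** The Stieltjes measure is restricted to []a, b]] to become finite, which makes its Radon-Nikodym
    density integrable on the whole line. *)
Lemma nondecreasing_abs_continuous_integral : exists g : R -> R,
  lebesgue_measure.-integrable setT (EFin \o g) /\
  forall x, a <= x <= b ->
    G x - G a = \int[lebesgue_measure]_(t in `[a, x]) g t.
Proof.
have mab : measurable (`]a, b]%classic : set (measurableTypeR R)).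
  exact: measurable_itv.
have nuab : (nu `]a, b]%classic < +oo)%E by rewrite nu_oc ?ltry.
pose m : {finite_measure set (measurableTypeR R) -> \bar R} := mfrestr mab nuab.
have mnull : m `<< lebesgue_measure.
  apply/null_content_dominatesP => A mA A0; rewrite /m /= /mfrestr /mrestr.
  apply: nu_null.
  - exact: measurableI.
  - move=> x [_]/=; rewrite !in_itv/= => /andP[ax xb]; apply/andP; split; lra.
  - apply/eqP; rewrite eq_le measure_ge0 andbT -A0.
    by apply: le_measure; rewrite ?inE//; exact: measurableI.
have [g [g0 gfin ig mg]] := radon_nikodym_sigma_finite mnull.
exists (fine \o g).
have gE : EFin \o (fine \o g) = g by apply/funext => x /=; rewrite fineK.
split; first by rewrite gE.
move=> x /andP[ax xb].
(* The increment of [G] is the Stieltjes measure of the half-open interval []a, x]]. *)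
rewrite -Rintegral_itv_obnd_cbnd; last first.
  by rewrite gE; exact: integrableS ig.
rewrite /Rintegral -[RHS]/(fine
  (\int[lebesgue_measure]_(t in `]a, x]) (EFin \o (fine \o g)) t)%E).
rewrite gE -mg; last exact: measurable_itv.
rewrite /m /= /mfrestr /mrestr setIidl; last first.
  by apply: subset_itvl; rewrite bnd_simp.
by rewrite [X in fine X](nu_oc ax) /= /Gc /= !clamp_id.
Qed.

End monotone.

Lemma abs_continuous_integral (R : realType) (a b : R) (f : R -> R) :
  a < b -> abs_continuous a b f -> exists g : R -> R,
  lebesgue_measure.-integrable setT (EFin \o g) /\
  forall x, a <= x <= b ->
    f x - f a = \int[lebesgue_measure]_(t in `[a, x]) g t.
Proof.
move=> ab fac; have ab' := ltW ab.
have BVf := abs_continuous_bounded_variation ab fac.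
pose V x := fine (total_variation a x f).
have TVfin x y : a <= x -> x <= y -> y <= b -> total_variation x y f \is a fin_num.
  move=> ax xy yb; apply/bounded_variationP => //; apply: (bounded_variationr ax xy).
  by apply: bounded_variationl BVf => //; exact: le_trans xy.
have Vac : abs_continuous a b V by exact: abs_continuous_total_variation.
(* This single bound gives the monotonicity of both [V] and [V \- f]. *)
have VB x y : a <= x -> x <= y -> y <= b -> `|f y - f x| <= V y - V x.
  move=> ax xy yb.
  rewrite /V (total_variationD _ ax xy) fineD ?TVfin//; last exact: le_trans yb.
  rewrite addrAC subrr add0r -lee_fin fineK ?TVfin//.
  exact: total_variation_ge.
have Vnd : {in `[a, b] &, nondecreasing_fun V}.
  move=> x y; rewrite !in_itv/= => /andP[ax xb] /andP[ay yb] xy.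
  by rewrite -subr_ge0; apply: le_trans (VB _ _ ax xy yb).
have Nnd : {in `[a, b] &, nondecreasing_fun (V \- f)}.
  move=> x y; rewrite !in_itv/= => /andP[ax xb] /andP[ay yb] xy.
  have := VB _ _ ax xy yb; have := ler_norm (f y - f x); rewrite /=; lra.
have [g [ig gE]] := nondecreasing_abs_continuous_integral ab' Vac Vnd.
have [h [ih hE]] :=
  nondecreasing_abs_continuous_integral ab' (abs_continuousB Vac fac) Nnd.
exists (g \- h); split.
  exact: (integrableB measurableT ig ih).
move=> x axb; rewrite RintegralB//; last 2 first.
- exact: integrableS ig.
- exact: integrableS ih.
by rewrite -gE// -hE//=; ring.
Qed.

(** * Almost everywhere derivatives *)

Lemma near_eq_derive1 (R : realType) (f g : R -> R) (x : R) :
  {near x, f =1 g} -> derivable f x 1 ->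
  derivable g x 1 /\ derive1 g x = derive1 f x.
Proof.
move=> fg df; split; first exact: near_eq_derivable fg df.
by rewrite !derive1E; apply: near_eq_derive; near do apply/esym.
Unshelve. all: by end_near. Qed.

(** [F] is known to be a primitive on [[a, b]] only, so it coincides with the function that Lebesgue
    differentiation treats in a neighbourhood of interior points. *)
Lemma ae_derive_integral (R : realType) (a b : R) (F w : R -> R) :
  lebesgue_measure.-integrable setT (EFin \o w) ->
  (forall x, a <= x <= b ->
    F x - F a = \int[lebesgue_measure]_(t in `[a, x]) w t) ->
  {ae lebesgue_measure, forall x, a < x < b ->
    derivable F x 1 /\ derive1 F x = w x}.
Proof.
move=> iw Fw.
have := @FTC1 _ w (BLeft a).
have iwS (y : R) : lebesgue_measure.-integrable
    [set` Interval (BLeft a) (BRight y)] (EFin \o w).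
  exact: integrableS iw.
move=> /(_ iwS (open_integrable_locally openT iw)).
apply: filterS; first exact: (ae_filter_ringOfSetsType lebesgue_measure).
move=> x dW /andP[ax xb].
have [dI IE] := dW ax.
set W := fun x : R => _ in dI IE.
have FW : {near x, W \+ cst (F a) =1 F}.
  near=> y; rewrite /W /= -Fw ?subrK//.
  apply/andP; split; apply: ltW; near: y; [exact: lt_nbhsr|exact: lt_nbhsl].
have dWc : is_derive x 1 (W \+ cst (F a)) (w x + 0).
  apply: is_deriveD; apply: DeriveDef => //; first by rewrite -derive1E.
have := near_eq_derive1 FW (@ex_derive _ _ _ _ _ _ _ dWc).
by rewrite [in X in _ /\ _ = X -> _]derive1E (@derive_val _ _ _ _ _ _ _ dWc) addr0.
Unshelve. all: by end_near. Qed.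

Section measurable_derive1.
Variables (R : realType) (f : R -> R).
Hypothesis cf : continuous f.

Let q (h x : R) : R := h^-1 * (f (h + x) - f x).

Let cq h : continuous (q h).
Proof.
move=> x; apply: cvgM; first exact: cvg_cst.
apply: cvgB; last exact: cf.
apply: (@continuous_comp _ _ _ (fun x => h + x) f); last exact: cf.
by apply: cvgD; [exact: cvg_cst|exact: cvg_id].
Qed.

Let derE x : derivable f x 1 = cvg (q h x @[h --> 0^']).
Proof.
  rewrite /derivable [X in (X @ _)](_ : _ = q ^~ x)//.
by apply/funext => h; rewrite /q /GRing.scale /= mulr1.
Qed.

(* All increments can be used, not only countably many: an arbitrary
   intersection of closed sets is closed. *)
Let E m n : set R := \bigcap_(h in [set h : R * R |
    0 < `|h.1| < n.+1%:R^-1 /\ 0 < `|h.2| < n.+1%:R^-1])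
  [set x | `|q h.1 x - q h.2 x| <= m.+1%:R^-1].

Let closed_E m n : closed (E m n).
Proof.
apply: closed_bigI => h _.
apply: (@preimage_closed _ _ (fun x => `|q h.1 x - q h.2 x|)
  [set r | r <= m.+1%:R^-1]); last exact: closed_le.
have cB : continuous (fun x => q h.1 x - q h.2 x).
  by move=> x; apply: cvgB; exact: cq.
by move=> x _; exact: (continuous_comp (cB x) (@norm_continuous _ R^o _)).
Qed.

(** Cauchy criterion for the difference quotients as the increment tends to 0. *)
Let derivableE : [set x | derivable f x 1] = \bigcap_m \bigcup_n E m n.
Proof.
apply/seteqP; split => [x /=|x Ex /=]; rewrite derE.
- move=> /cvg_ex[l /cvgrPdist_lt ql] m _.
  have [|d /= d0 dE] := ql ((m.+1%:R^-1) / 2); first by rewrite divr_gt0.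
  have [n nd] : exists n : nat, n.+1%:R^-1 < d.
    exists (Num.truncn d^-1); rewrite invf_plt ?posrE//; exact: truncnS_gt.
  exists n => // -[h h'] /= [/andP[h0 hn] /andP[h'0 h'n]].
  have lq y : 0 < `|y| -> `|y| < n.+1%:R^-1 -> `|l - q y x| < m.+1%:R^-1 / 2.
    move=> y0 yn; apply: dE; last by rewrite -normr_gt0.
    by rewrite /= sub0r normrN (lt_trans yn).
  rewrite -(subrKA l) (le_trans (ler_normD _ _))// [leRHS]splitr lerD// ltW//.
  + by rewrite distrC; exact: lq.
  + exact: lq.
- apply: (@cauchy_cvg R); apply: cauchy_exP => e e0.
  have [m me] : exists m : nat, m.+1%:R^-1 < e.
    exists (Num.truncn e^-1); rewrite invf_plt ?posrE//; exact: truncnS_gt.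
  have [n _ En] := Ex m I.
  (* Any fixed admissible increment serves: the quotients for all small [h] lie within [e] of the
     one for [h0]. *)
  pose h0 : R := n.+1%:R^-1 / 2.
  have h00 : 0 < h0 by rewrite divr_gt0.
  exists (q h0 x); apply/nbhs_ballP; exists n.+1%:R^-1; first by rewrite /= invr_gt0.
  move=> h; rewrite /ball/= sub0r normrN => hn hneq0.
  apply: le_lt_trans me; apply: (En (h0, h)); split => /=; last first.
    by rewrite normr_gt0 hneq0 hn.
  rewrite gtr0_norm// h00 /h0 ltr_pdivrMr// ltr_pMr ?invr_gt0//.
  by rewrite ltr1n.
Qed.

(** On the set of differentiability the derivative is the limit of the continuous quotients with
    increments 1/(n+1). Elsewhere [lim] takes its default value, so [derive1 f] is constant
    there. *)
Lemma measurable_derive1 : measurable_fun setT (derive1 f).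
Proof.
pose D := [set x | derivable f x 1].
have mD : measurable D.
  rewrite /D derivableE; apply: bigcapT_measurable => m.
  by apply: bigcupT_measurable => n; exact: closed_measurable.
rewrite -(setUv D); apply/measurable_funU => //; first exact: measurableC.
split.
- apply: (@measurable_fun_cvg _ _ _ _ (fun n x => q n.+1%:R^-1 x)).
  + by move=> n; apply: measurable_funTS; exact: continuous_measurable_fun.
  + move=> x Dx.
    have qx : q h x @[h --> 0^'] --> derive1 f x.
      by have := Dx; rewrite /D /= derE => /cvg_ex[l ql]; rewrite /derive1 (cvg_lim _ ql).
    move/cvgr_dnbhsP : qx => /(_ (fun n => n.+1%:R^-1)); apply; split.
      by move=> n; rewrite invr_eq0.
    exact: cvg_harmonic.
- apply: (eq_measurable_fun (cst (point : R))) => [x|]; last exact: measurable_cst.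
  rewrite inE => nDx /=; rewrite /derive1; apply/esym.
  by apply: dvgP; rewrite -derE.
Qed.
End measurable_derive1.

(** * The kernel *)

(* The value of [E1] at nonpositive arguments is arbitrary, hence the
   truncation. *)
Definition E1_kernel (R : realType) (alpha s : R) : R :=
  if 0 < s then alpha^-1 * E1 (s / alpha) else 0.

Section E1_kernel.
Variables (R : realType) (alpha : R).
Hypothesis alpha_gt0 : 0 < alpha.
Notation mu := (@lebesgue_measure R).

Let r : R -> R := (fun t => expR (- t) / t) \_ `]0, +oo[.

Let rE t : 0 < t -> r t = expR (- t) / t.
Proof. by move=> t0; rewrite /r patchE mem_set//= in_itv/= t0. Qed.

Let r_ge0 t : 0 <= r t.
Proof.
apply: restrict_ge0 => {}t /=; rewrite in_itv/= andbT => t0.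
by rewrite divr_ge0 ?expR_ge0// ltW.
Qed.

Let measurable_r : measurable_fun setT r.
Proof.
apply/(measurable_restrictT _ _).1 => //.
apply: open_continuous_measurable_fun => [|t].
  by rewrite (_ : `]0, +oo[%classic = [set x : R | 0 < x]) ?set_itvoy//; exact: open_gt.
rewrite inE/= in_itv/= andbT => t0; apply: cvgM; last first.
  by apply: cvgV; [rewrite gt_eqF|exact: cvg_id].
apply: (@continuous_comp _ _ _ -%R expR); first exact: opp_continuous.
exact: continuous_expR.
Qed.

(** For 0 < s the section of [H] at [s] is the integrand of [E1 (s / alpha)]; measurability and
    integrability of the kernel then follow from Tonelli's theorem for [H]. *)
Let H (z : R * R) : R := if (0 < z.1) && (z.1 / alpha <= z.2) then r z.2 else 0.

Let H_ge0 z : 0 <= H z.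
Proof. by rewrite /H; case: ifPn. Qed.

Let measurable_H : measurable_fun setT H.
Proof.
apply: measurable_fun_ifT.
- apply: measurable_and.
    by apply: measurable_fun_ltr; [exact: measurable_cst|exact: measurable_fst].
  apply: measurable_fun_ler; last exact: measurable_snd.
  by apply: measurable_funM; [exact: measurable_fst|exact: measurable_cst].
- by apply: measurableT_comp; [exact: measurable_r|exact: measurable_snd].
- exact: measurable_cst.
Qed.

Let kE s : E1_kernel alpha s = alpha^-1 * fine (\int[mu]_t (H (s, t))%:E)%E.
Proof.
rewrite /E1_kernel; case: ifPn => s0; last first.
  rewrite (eq_integral (fun=> 0%E)) ?integral0 ?mulr0// => t _.
  by rewrite /H /= (negbTE s0).
congr (_ * _); rewrite /E1 /Rintegral integral_mkcond; congr fine.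
apply: eq_integral => t _; rewrite /H/= s0/= patchE mem_setE in_itv/= andbT.
by case: ifPn => // st; rewrite rE// (lt_le_trans _ st)// divr_gt0.
Qed.

Lemma E1_kernel_ge0 s : 0 <= E1_kernel alpha s.
Proof.
rewrite kE mulr_ge0//; first by rewrite invr_ge0 ltW.
by rewrite fine_ge0// integral_ge0// => t _; rewrite lee_fin.
Qed.

Let measurable_int_H : measurable_fun setT (fun s => \int[mu]_t (H (s, t))%:E)%E.
Proof.
apply: (@measurable_fun_fubini_tonelli_F _ _ _ _ _ mu (EFin \o H)) => [|z].
  exact/measurable_EFinP.
by rewrite lee_fin.
Qed.

Lemma measurable_E1_kernel : measurable_fun setT (E1_kernel alpha).
Proof.
rewrite (_ : E1_kernel alpha = fun s => alpha^-1 * fine (\int[mu]_t (H (s, t))%:E)%E).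
  apply: measurable_funM; first exact: measurable_cst.
  by apply: measurableT_comp; [exact: fine_measurable|exact: measurable_int_H].
by apply/funext => s; rewrite kE.
Qed.

(** For 0 < t the section is constant on []0, alpha * t]]: the length of this interval cancels the
    denominator of [r t] and leaves [alpha * expR (- t)]. The exponential density is used because
    its integral is known to be 1. *)
Let int_H_le t : (\int[mu]_s (H (s, t))%:E <= (alpha * exponential_pdf 1 t)%:E)%E.
Proof.
have [t0|t0] := leP t 0.
  rewrite (eq_integral (fun=> 0%E)) ?integral0; last first.
    move=> s _; rewrite /H /=; case: ifPn => // /andP[s0 st].
    have := lt_le_trans (divr_gt0 s0 alpha_gt0) st.
    by rewrite ltNge t0.
  by rewrite lee_fin mulr_ge0 ?exponential_pdf_ge0// ltW.
rewrite (_ : (fun s => (H (s, t))%:E) = (cst (r t)%:E) \_ `]0, alpha * t]); last first.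
  apply/funext => s; rewrite patchE mem_setE in_itv/= /H /=.
  by rewrite ler_pdivrMr// mulrC; case: ifPn.
rewrite -integral_mkcond integral_cst//.
rewrite [X in (_ * X)%E]lebesgue_measure_itv/= lte_fin mulr_gt0// sube0 -EFinM lee_fin.
rewrite rE// (exponential_pdfE _ (ltW t0)) mul1r mulN1r.
by rewrite mulrCA divfK ?gt_eqF.
Qed.

Lemma integrable_E1_kernel : mu.-integrable setT (EFin \o E1_kernel alpha).
Proof.
apply/integrableP; split; first by apply/measurable_EFinP; exact: measurable_E1_kernel.
(* Only an inequality, because [fine] would send an infinite integral to 0. *)
have kle s : (`|(E1_kernel alpha s)%:E| <=
    (alpha^-1)%:E * \int[mu]_t (H (s, t))%:E)%E.
  rewrite gee0_abs ?lee_fin ?E1_kernel_ge0// kE EFinM.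
  rewrite lee_pmul2l// ?lte_fin ?invr_gt0//.
  have : (0 <= \int[mu]_t (H (s, t))%:E)%E.
    by apply: integral_ge0 => t _; rewrite lee_fin.
  by case: (\int[mu]_t _)%E => //= _; rewrite leey.
apply: (@le_lt_trans _ _ (\int[mu]_s ((alpha^-1)%:E * \int[mu]_t (H (s, t))%:E))%E).
  apply: ge0_le_integral => //.
  - apply: measurableT_comp => //; apply/measurable_EFinP; exact: measurable_E1_kernel.
  - apply: emeasurable_funM; [exact: measurable_cst|exact: measurable_int_H].
  - by move=> s _; apply: kle.
rewrite ge0_integralZl//; last 2 first.
- by move=> s _; apply: integral_ge0 => t _; rewrite lee_fin.
- by rewrite lee_fin invr_ge0 ltW.
apply: lte_mul_pinfty => //; first by rewrite lee_fin invr_ge0 ltW.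
rewrite (@fubini_tonelli _ _ _ _ _ mu mu (EFin \o H)); last 2 first.
- exact/measurable_EFinP.
- by move=> z; rewrite lee_fin.
apply: (@le_lt_trans _ _ (\int[mu]_t (alpha * exponential_pdf 1 t)%:E)%E).
  apply: ge0_le_integral => //.
  - by move=> t _; apply: integral_ge0 => s _; rewrite lee_fin.
  - apply: (@measurable_fun_fubini_tonelli_G _ _ _ _ _ mu (EFin \o H)) => [|z].
      exact/measurable_EFinP.
    by rewrite lee_fin.
  - apply/measurable_EFinP; apply: measurable_funM => //.
    exact: measurable_exponential_pdf.
  - by move=> t _; exact: int_H_le.
under eq_integral do rewrite EFinM.
rewrite ge0_integralZl//; last 3 first.
- by apply/measurable_EFinP; exact: measurable_exponential_pdf.
- by move=> t _; rewrite lee_fin exponential_pdf_ge0.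
- by rewrite lee_fin ltW.
by rewrite integral_exponential_pdf// mule1 ltry.
Qed.

End E1_kernel.

(** * Convolution with a causal kernel *)

Section reflection.
Variables (R : realType) (c : R).
Notation mu := (@lebesgue_measure R).
Let rho : measurableTypeR R -> measurableTypeR R := fun u => c - u.

Let measurable_rho : measurable_fun setT rho.
Proof. by apply: measurable_funB; [exact: measurable_cst|exact: measurable_id]. Qed.

(** It is enough to compare the measures on the intervals []u, v]]; reflection swaps the closed and
    the open end and keeps the length. *)
Let pushforward_rho (A : set R) : measurable A -> pushforward mu rho A = mu A.
Proof.
move=> mA; apply/esym.
apply: lebesgue_measure_unique => //= _ [[u v]] _ <-.
rewrite /pushforward (_ : rho @^-1` _ = `[c - v, c - u[%classic); last first.
  apply/seteqP; split => z /=; rewrite !in_itv/= /rho; lra.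
rewrite !lebesgue_measure_itv/= !lte_fin ltrD2l ltrN2.
by congr (if _ then _ else _); rewrite -!EFinB; congr EFin; ring.
Qed.

Lemma ge0_integral_reflect (h : R -> \bar R) : measurable_fun setT h ->
  (forall x, 0 <= h x)%E -> (\int[mu]_x h (c - x)%R = \int[mu]_x h x)%E.
Proof.
move=> mh h0; have := @ge0_integral_pushforward _ _ _ _ _ _ measurable_rho mu setT h.
rewrite preimage_setT => <-//.
by apply: eq_measure_integral => A mA _; exact: pushforward_rho mA.
Qed.

Lemma integrable_reflect (h : R -> \bar R) : mu.-integrable setT h ->
  mu.-integrable setT (fun x => h (c - x)).
Proof.
move=> ih; have mh := measurable_int _ ih.
apply/integrableP; split; first exact: (measurableT_comp mh measurable_rho).
rewrite (ge0_integral_reflect (h := abse \o h))//.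
- by case/integrableP : ih.
- exact: measurableT_comp.
- by move=> x; exact: abse_ge0.
Qed.

Lemma integral_reflect (h : R -> \bar R) : mu.-integrable setT h ->
  (\int[mu]_x h (c - x)%R = \int[mu]_x h x)%E.
Proof.
move=> ih; have mh := measurable_int _ ih.
have := @integral_pushforward _ _ _ _ _ _ measurable_rho mu setT h mh.
rewrite preimage_setT => <-//; last exact: integrable_reflect.
by apply: eq_measure_integral => A mA _; exact: pushforward_rho mA.
Qed.

End reflection.

Section convolution.
Variables (R : realType) (k g : R -> R) (a : R).
Notation mu := (@lebesgue_measure R).
Hypotheses (ik : mu.-integrable setT (EFin \o k))
  (ig : mu.-integrable setT (EFin \o g)).

Definition convolution (y : R) : R := \int[mu]_u (k u * g (y - u)).

Let Phi (z : R * R) : \bar R := (k z.2 * g (z.1 - z.2))%:E.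

Let mk : measurable_fun setT k.
Proof. by apply/measurable_EFinP; exact: measurable_int ik. Qed.

Let mg : measurable_fun setT g.
Proof. by apply/measurable_EFinP; exact: measurable_int ig. Qed.

Let measurable_Phi : measurable_fun setT Phi.
Proof.
have mB : measurable_fun setT (fun z : R * R => z.1 - z.2).
  by apply: measurable_funB; [exact: measurable_fst|exact: measurable_snd].
apply/measurable_EFinP; apply: measurable_funM.
  by apply: measurableT_comp; [exact: mk|exact: measurable_snd].
exact: (measurableT_comp mg mB).
Qed.

(** A translation is the composite of two reflections. *)
Lemma integrable_translate (h : R -> \bar R) (u : R) : mu.-integrable setT h ->
  mu.-integrable setT (fun y => h (y - u)).
Proof.
move=> /(integrable_reflect 0)/(integrable_reflect u).
by apply: eq_integrable => // y _; congr h; ring.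
Qed.

Lemma integral_translate (h : R -> \bar R) (u : R) : mu.-integrable setT h ->
  (\int[mu]_y h (y - u)%R = \int[mu]_y h y)%E.
Proof.
move=> ih; rewrite -[RHS](integral_reflect 0 ih).
rewrite -(integral_reflect u (integrable_reflect 0 ih)).
by apply: eq_integral => y _; congr h; ring.
Qed.

(** Integrating first in y, translation invariance turns the double integral of the absolute value
    into the product of the L1 norms of [k] and [g]. *)
Let integrable_Phi : (mu \x mu)%E.-integrable setT Phi.
Proof.
apply/integrable21ltyP => //.
have igb : mu.-integrable setT (fun y => `|(g y)%:E|)%E by exact: integrable_abse.
have ikb : mu.-integrable setT (fun y => `|(k y)%:E|)%E by exact: integrable_abse.
have gfin := integrable_fin_num measurableT igb.
rewrite [X in (X < _)%E](_ : _ =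
    \int[mu]_u (`|(k u)%:E| * \int[mu]_y `|(g y)%:E|))%E; last first.
  apply: eq_integral => u _; rewrite -(integral_translate u igb) -ge0_integralZl//.
  - by apply: eq_integral => y _; rewrite /Phi /= normrM EFinM.
  - exact: measurable_int (integrable_translate u igb).
have g0 : 0 <= fine (\int[mu]_y `|(g y)%:E|)%E by rewrite fine_ge0// integral_ge0.
rewrite -(fineK gfin); move: (fine _) g0 => M M0.
under eq_integral do rewrite muleC.
rewrite ge0_integralZl//; last exact: measurable_int ikb.
by rewrite lte_mul_pinfty//; have /integrableP[_] := ik.
Qed.

Lemma ae_integrable_convolution :
  {ae mu, forall y, mu.-integrable setT (fun u => (k u * g (y - u))%:E)}.
Proof. exact: ae_integrable1 integrable_Phi. Qed.

Lemma integrable_convolution : mu.-integrable setT (EFin \o convolution).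
Proof.
have iG := integrable_fubini_F integrable_Phi.
have mconv : measurable_fun setT convolution.
  apply: (measurableT_comp (fine_measurable measurableT)).
  exact: measurable_int iG.
(* Domination rather than equality: [fine] gives 0 where the inner integral is infinite. *)
apply: (le_integrable measurableT _ _ iG) => [|y _]; first exact/measurable_EFinP.
rewrite /convolution /Rintegral /fubini_F /Phi /=.
by case: (integral _ _ _) => //=; rewrite normr0 leey.
Qed.

Hypotheses (k0 : forall s, s <= 0 -> k s = 0) (g0 : forall s, s < a -> g s = 0).

Let G (t : R) : R := \int[mu]_(s in `[a, t]) g s.

Let G_lt t : t < a -> G t = 0.
Proof. by move=> ta; rewrite /G set_itv_ge ?Rintegral_set0// bnd_simp -ltNge. Qed.

Lemma convolution_lt y : y < a -> convolution y = 0.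
Proof.
move=> ya; rewrite /convolution /Rintegral (eq_integral (fun=> 0%E)) ?integral0// => u _.
have [u0|u0] := leP u 0; first by rewrite k0// mul0r.
by rewrite g0 ?mulr0// (lt_trans _ ya)// gtrBl.
Qed.

Section truncation.
Variable x : R.

(** Integrating over [[a, x]] amounts to cutting off above [x], since the convolution vanishes below
    [a]. *)
Let Psi (z : R * R) : \bar R := if z.1 <= x then Phi z else 0%E.

Let integrable_Psi : (mu \x mu)%E.-integrable setT Psi.
Proof.
apply: (le_integrable measurableT _ _ integrable_Phi) => [|z _].
  apply: measurable_fun_ifT => //.
  by apply: measurable_fun_ler; [exact: measurable_fst|exact: measurable_cst].
by rewrite /Psi; case: ifPn => //; rewrite abse0 abse_ge0.
Qed.

(** For fixed [u] the cut-off reads y - u <= x - u, and [g] vanishes below [a]; translating by [u]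
    leaves the integral of [g] over [[a, x - u]]. *)
Let Psi_G u : fubini_G mu Psi u = (k u * G (x - u))%:E.
Proof.
pose gx := g \_ `[a, x - u].
have igx : mu.-integrable setT (EFin \o gx).
  by rewrite /gx -restrict_EFin -integrable_mkcond//; exact: integrableS ig.
rewrite /fubini_G; transitivity (\int[mu]_y ((k u)%:E * (EFin \o gx) (y - u)%R))%E.
  apply: eq_integral => y _; rewrite /Psi /Phi /gx /= patchE mem_setE in_itv/= lerD2r.
  case: leP => yx; last by rewrite andbF mule0.
  rewrite andbT -EFinM; case: leP => // ay; by rewrite g0.
rewrite integralZl//; last exact: (integrable_translate u igx).
rewrite (integral_translate u igx) EFinM; congr (_ * _)%E.
rewrite /G Rintegral_mkcond -/gx /Rintegral fineK//.
exact: (integrable_fin_num measurableT igx).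
Qed.

Let M := (\int[mu]_y `|g y|).

Let G_le t : `|G t| <= M.
Proof.
have igb : mu.-integrable setT (EFin \o (fun y => `|g y|)).
  exact: (integrable_abse ig).
apply: (@le_trans _ _ (\int[mu]_(s in `[a, t]) `|g s|)).
  by apply: le_normr_Rintegral => //; exact: integrableS ig.
apply: fine_le.
- by apply: integrable_fin_num => //; exact: integrableS igb.
- exact: (integrable_fin_num measurableT igb).
- apply: ge0_subset_integral => //; exact: measurable_int igb.
Qed.

(** Measurability comes from Fubini's theorem, the function being a partial integral of [Psi]; the
    L1 norm of [g] bounds [G]. *)
Let integrable_kG : mu.-integrable setT (fun u => (k u * G (x - u))%:E).
Proof.
have iMk : mu.-integrable setT (fun u => M%:E * (EFin \o k) u)%E.
  exact: integrableZl.
apply: (le_integrable measurableT _ _ iMk) => [|u _].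
  rewrite (_ : (fun _ => _) = fubini_G mu Psi); last first.
    by apply/funext => u; rewrite Psi_G.
  exact: (measurable_fubini_G integrable_Psi).
rewrite -EFinM !abse_EFin lee_fin !normrM mulrC ler_wpM2r//.
by rewrite (le_trans (G_le _))// ler_norm.
Qed.

Lemma integrable_convolution_primitive :
  mu.-integrable setT (fun t => (k (x - t) * G t)%:E).
Proof.
apply: eq_integrable (integrable_reflect x integrable_kG) => // t _ /=.
by congr (_ * G _)%:E; ring.
Qed.

(** A primitive of [k * g] is [k * G]: both sides are iterated integrals of [Psi], in the two
    orders. *)
Lemma integral_convolution :
  \int[mu]_(y in `[a, x]) convolution y = \int[mu]_(t in `[a, x]) (k (x - t) * G t).
Proof.
rewrite /Rintegral; congr fine.
transitivity (\int[mu]_y fubini_F mu Psi y)%E.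
  rewrite integral_mkcond; apply: ae_eq_integral => //.
  - apply/(measurable_restrictT _ _).1 => //; apply: measurable_funTS.
    exact: measurable_int integrable_convolution.
  - exact: (measurable_fubini_F integrable_Psi).
  - move: ae_integrable_convolution; apply: filterS.
      exact: (ae_filter_ringOfSetsType mu).
    move=> y iy _; rewrite /fubini_F patchE mem_setE in_itv/= /Psi/=.
    have [yx|xy] := leP y x; last by rewrite andbF integral0.
    rewrite andbT -[RHS]fineK; last exact: integrable_fin_num.
    rewrite -[fine _]/(convolution y).
    by have [//|ya] := leP a y; rewrite convolution_lt.
rewrite (integral12_prod_meas1 integrable_Psi) -(integral21_prod_meas1 integrable_Psi).
transitivity (\int[mu]_u (k u * G (x - u))%:E)%E.
  by apply: eq_integral => u _; exact: Psi_G.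
(* After substituting u = x - t, the integrand vanishes for t < a because of [G] and for x < t
   because of [k]. *)
rewrite -(integral_reflect x integrable_kG) [RHS]integral_mkcond.
apply: eq_integral => t _; rewrite patchE mem_setE in_itv/=.
rewrite (_ : x - (x - t) = t); last by ring.
case: ifPn => //; rewrite negb_and -!ltNge => /orP[ta|xt].
  by rewrite G_lt// mulr0.
by rewrite k0 ?mul0r// subr_le0 ltW.
Qed.

Lemma integral_kernel_reflect :
  \int[mu]_(t in `[a, x]) k (x - t) = \int[mu]_(y in `[a, x]) k (y - a).
Proof.
pose h := (fun t => k (x - t)) \_ `[a, x].
have ih : mu.-integrable setT (EFin \o h).
  rewrite /h -restrict_EFin -integrable_mkcond//.
  by apply: integrableS (integrable_reflect x ik).
rewrite [LHS]Rintegral_mkcond [RHS]Rintegral_mkcond; congr fine.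
rewrite -[LHS](integral_reflect (x + a) ih); apply: eq_integral => y _.
have axy : (a <= x + a - y <= x) = (a <= y <= x) by apply/idP/idP; lra.
have xy : x - (x + a - y) = y - a by ring.
by rewrite /h /= !patchE !mem_setE !in_itv/= axy xy.
Qed.

Lemma integrable_kernel_primitive (c : R) :
  mu.-integrable `[a, x] (EFin \o (fun t => k (x - t) * (c + G t))).
Proof.
have ik1 : mu.-integrable `[a, x] (fun t => c%:E * (k (x - t))%:E)%E.
  by apply: integrableZl => //; apply: integrableS (integrable_reflect x ik).
have ikG : mu.-integrable `[a, x] (fun t => (k (x - t) * G t)%:E).
  exact: integrableS integrable_convolution_primitive.
apply: eq_integrable (integrableD _ ik1 ikG) => // t _ /=.
by rewrite -EFinM -EFinD; congr EFin; ring.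
Qed.

(** With [c] equal to [f a], the factor [c + G t] is [f t], and this is the formula that exhibits
    the fractional integral as a primitive. *)
Lemma integral_kernel_primitive (c : R) :
  \int[mu]_(t in `[a, x]) (k (x - t) * (c + G t)) =
  \int[mu]_(y in `[a, x]) (c * k (y - a) + convolution y).
Proof.
have ik1 : mu.-integrable `[a, x] (EFin \o (fun t => k (x - t))).
  by apply: integrableS (integrable_reflect x ik).
have ik2 : mu.-integrable `[a, x] (EFin \o (fun t => k (t - a))).
  by apply: integrableS (integrable_translate a ik).
have cZ h : mu.-integrable `[a, x] (EFin \o h) ->
    mu.-integrable `[a, x] (EFin \o (fun t => c * h t)).
  by move=> ih; apply: (@integrableZl _ _ _ mu _ _ c (EFin \o h)).
under eq_Rintegral do rewrite mulrDr [_ * c]mulrC.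
rewrite !RintegralD//.
- by rewrite integral_convolution !RintegralZl// integral_kernel_reflect.
- exact: (cZ _ ik2).
- by apply: integrableS integrable_convolution.
- exact: (cZ _ ik1).
- by apply: integrableS integrable_convolution_primitive.
Qed.

End truncation.

End convolution.

(** * Absolutely continuous representatives *)

(** The increments of [F] are bounded by the integral of [|w|] over the union of the intervals, a
    set of measure less than [d]. *)
Lemma integral_abs_continuous (R : realType) (a b : R) (F w : R -> R) :
  lebesgue_measure.-integrable setT (EFin \o w) ->
  (forall x, a <= x <= b -> F x = \int[lebesgue_measure]_(t in `[a, x]) w t) ->
  abs_continuous a b F.
Proof.
move=> iw Fw e e0.
have iwS (A : set R) : measurable A -> lebesgue_measure.-integrable A (EFin \o w).
  by move=> mA; exact: integrableS iw.
have ibS (A : set R) : measurable A ->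
    lebesgue_measure.-integrable A (EFin \o (fun t => `|w t|)).
  by move=> mA; exact: (integrable_abse (iwS _ mA)).
have [d [d0 wd]] := integral_normr_continuous iw e0.
exists d => // n u v uv tuv luv.
pose D := \big[setU/set0]_(i < n) `]u i, v i[%classic.
have mD : measurable D by apply: bigsetU_measurable => i _; exact: measurable_itv.
have Dd : (lebesgue_measure D < d%:E)%E.
  rewrite /D measure_bigsetU_ord//.
  apply: le_lt_trans (_ : (\sum_(i < n) (v i - u i))%:E < d%:E)%E;
    last by rewrite lte_fin.
  rewrite -sumEFin; apply: lee_sum => i _; have [_ [uvi _]] := uv i.
  rewrite [leLHS]lebesgue_measure_itv/= lte_fin.
  by case: ltP; rewrite // lee_fin subr_ge0.
apply: le_lt_trans (wd D mD Dd).
rewrite -lee_fin /Rintegral fineK; last first.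
  apply: integrable_fin_num => //; exact: ibS.
rewrite /D ge0_integral_bigsetU//; last 3 first.
- exact: index_enum_uniq.
- exact: sub_trivIset tuv.
- exact: measurable_int (ibS _ mD).
rewrite -sumEFin; apply: lee_sum => i _; have [au [uvi vb]] := uv i.
rewrite !Fw ?au ?(le_trans au uvi) ?(le_trans uvi vb)//.
rewrite Rintegral_itvB//; [|exact: iwS|by rewrite bnd_simp..].
rewrite -Rintegral_itv_bndo_bndc; last exact: iwS.
rewrite -[leRHS]fineK; last by apply: integrable_fin_num => //; exact: ibS.
by rewrite lee_fin; apply: le_normr_Rintegral => //; exact: iwS.
Qed.

(** Both functions are continuous on [[a, b]], and every neighbourhood of [x] meets [[a, b]] in a
    set of positive measure, hence contains a point [y] where they agree. *)
Lemma is_AC_rep_unique (R : realType) (a b : R) (g F H : R -> R) :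
  a < b -> is_AC_rep a b g F -> is_AC_rep a b g H ->
  forall x, a <= x <= b -> F x = H x.
Proof.
move=> ab [Fac gF] [Hac gH] x axb; apply/eqP; rewrite -subr_eq0 -normr_le0.
suff FH_le (e : R) : 0 < e -> `|F x - H x| <= e.
  by apply/ler_addgt0Pr => e e0; rewrite add0r FH_le.
move=> e0.
have e20 : 0 < e / 2 by rewrite divr_gt0.
have [d d0 Fd] := abs_continuous_dist Fac e20.
have [d' d'0 Hd] := abs_continuous_dist Hac e20.
pose r := Num.min d d'.
have r0 : 0 < r by rewrite lt_min d0.
pose I := `]Num.max a (x - r), Num.min b (x + r)[%classic.
have [y [Iy FHy]] : exists y, I y /\ F y = H y.
  apply: contrapT => /forallNP nFH.
  have nI : lebesgue_measure.-negligible I.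
    have FH : {ae lebesgue_measure, forall y, y \in `[a, b] -> F y = H y}.
      apply: filterS2 gF gH.
        exact: (ae_filter_ringOfSetsType lebesgue_measure).
      by move=> y gFy gHy yab; rewrite -gFy// -gHy.
    apply: negligibleS FH => y Iy /=; apply/not_implyP; split.
      move: Iy; rewrite /I /= !in_itv/= gt_max lt_min.
      by move=> /andP[/andP[/ltW -> _] /andP[/ltW -> _]].
    by move=> Fy; apply: (nFH y).
  have I0 : lebesgue_measure I = 0%E.
    by apply: measure_negligible nI; exact: measurable_itv.
  have nondeg : Num.max a (x - r) < Num.min b (x + r).
    by case/andP: axb => ax xb; rewrite gt_max !lt_min; apply/andP; split; lra.
  move/eqP: I0; rewrite /I lebesgue_measure_itv/= lte_fin nondeg -EFinB eqe.
  by rewrite subr_eq0 gt_eqF.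
have yab : a <= y <= b.
  move: Iy; rewrite /I /= !in_itv/= gt_max lt_min.
  by move=> /andP[/andP[/ltW -> _] /andP[/ltW -> _]].
have xyr : `|x - y| < r.
  move: Iy; rewrite /I /= !in_itv/= gt_max lt_min.
  move=> /andP[/andP[_ xr] /andP[_ yr]].
  by rewrite distrC ltr_distl xr yr.
rewrite (_ : F x - H x = (F x - F y) - (H x - H y)); last by rewrite FHy; ring.
rewrite (le_trans (ler_normB _ _))// [leRHS]splitr lerD// ltW//.
- by apply: Fd => //; rewrite (lt_le_trans xyr)// ge_min lexx.
- by apply: Hd => //; rewrite (lt_le_trans xyr)// ge_min lexx orbT.
Qed.

Lemma ae_eq_integrable_Rintegral (R : realType) (D : set R) (f g : R -> R) :
  measurable D -> measurable_fun D g ->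
  lebesgue_measure.-integrable D (EFin \o f) ->
  {ae lebesgue_measure, forall x, D x -> f x = g x} ->
  lebesgue_measure.-integrable D (EFin \o g) /\
  \int[lebesgue_measure]_(x in D) g x = \int[lebesgue_measure]_(x in D) f x.
Proof.
move=> mD mg intf fg; have mf := measurable_int _ intf.
have mEg : measurable_fun D (EFin \o g) by exact/measurable_EFinP.
have aefg : ae_eq lebesgue_measure D (EFin \o f) (EFin \o g).
  apply: filterS fg; first exact: (ae_filter_ringOfSetsType lebesgue_measure).
  by move=> x fgx Dx; rewrite /= fgx.
split; last by rewrite /Rintegral; congr fine; apply/esym; exact: ae_eq_integral.
apply/integrableP; split => //.
rewrite [ltLHS](_ : _ = \int[lebesgue_measure]_(x in D) `|(EFin \o f) x|)%E.
  by have /integrableP[] := intf.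
apply: ae_eq_integral => //; [exact: measurableT_comp|exact: measurableT_comp|].
by apply: filterS aefg => x fgx Dx; congr abse; rewrite (fgx Dx).
Qed.

Theorem theorem4p9 (R : realType) (alpha a b : R) (f : R -> R) :
  0 < alpha -> a < b -> abs_continuous a b f ->
  frac_deriv_exists_ae alpha a b f /\
  {ae @lebesgue_measure R, forall x, x \in `[a, b] ->
     (@lebesgue_measure R).-integrable `[a, x]
       (EFin \o (fun y => alpha^-1 * E1 ((x - y) / alpha) * derive1 f y)) /\
     frac_deriv alpha a b f x =
       f a * (alpha^-1 * E1 ((x - a) / alpha)) +
       \int[@lebesgue_measure R]_(y in `[a, x])
          (alpha^-1 * E1 ((x - y) / alpha) * derive1 f y)}.
Proof.
move=> alpha0 ab fac; have ab' := ltW ab.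
have ae_ne (c : R) : {ae @lebesgue_measure R, forall x, x != c}.
  exists [set c]; split => //; first exact: lebesgue_measure_set1.
  by move=> x /=; apply: contra_notP => /eqP.
pose fc := f \o clamp a b.
have fcE x : a <= x <= b -> fc x = f x.
  by move=> /andP[ax xb]; rewrite /fc /= clamp_id.
have cfc : continuous fc by exact: abs_continuous_clamp_continuous.
have [g0 [ig0 fg0]] := abs_continuous_integral ab fac.
(* Cutting the density off makes it vanish below [a], as the causal convolution requires. *)
pose g := g0 \_ `[a, b].
have ig : lebesgue_measure.-integrable setT (EFin \o g).
  by rewrite /g -restrict_EFin -integrable_mkcond//; exact: integrableS ig0.
have g_lt s : s < a -> g s = 0.
  by move=> sa; rewrite /g patchE mem_setE in_itv/= leNgt sa.
have gE x : a <= x <= b -> \int[lebesgue_measure]_(t in `[a, x]) g t = f x - f a.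
  move=> /andP[ax xb]; rewrite fg0 ?ax//; apply: eq_Rintegral => t.
  rewrite inE/= in_itv/= => /andP[at_ tx].
  by rewrite /g patchE mem_setE in_itv/= at_ (le_trans tx xb).
pose k := E1_kernel alpha.
have ik : lebesgue_measure.-integrable setT (EFin \o k) := integrable_E1_kernel alpha0.
have k_le (s : R) : s <= 0 -> k s = 0 by move=> s0; rewrite /k /E1_kernel ltNge s0.
have kE (s : R) : 0 < s -> alpha^-1 * E1 (s / alpha) = k s.
  by move=> s0; rewrite /k /E1_kernel s0.
have mk := measurable_E1_kernel alpha0.
have mkx (x : R) : measurable_fun setT (fun t : R => k (x - t)).
  apply: (measurableT_comp mk).
  by apply: measurable_funB; [exact: measurable_cst|exact: measurable_id].
pose w y := f a * k (y - a) + convolution k g y.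
have iw : lebesgue_measure.-integrable setT (EFin \o w).
  have i1 : lebesgue_measure.-integrable setT (fun y => (f a)%:E * (k (y - a))%:E)%E.
    by apply: integrableZl => //; exact: (integrable_translate a ik).
  by have := integrableD measurableT i1 (integrable_convolution ik ig).
pose F x := \int[lebesgue_measure]_(t in `[a, x]) w t.
have JF x : a <= x <= b -> frac_int alpha a f x = F x.
  move=> axb; have /andP[ax xb] := axb.
  have iK := integrable_kernel_primitive ik ig g_lt x (f a).
  rewrite /F -(integral_kernel_primitive ik ig k_le g_lt x (f a)).
  pose K t := k (x - t) * (f a + \int[lebesgue_measure]_(s in `[a, t]) g s).
  (* The endpoint t = x is left out: there [E1] is evaluated at 0, where it is arbitrary, while
     [k 0] is 0. *)
  have EK : {in `[a, x[,
      (fun t => alpha * K t) =1 (fun t => E1 ((x - t) / alpha) * f t)}.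
    move=> t; rewrite in_itv/= => /andP[at_ tx].
    rewrite /K gE ?at_ ?(ltW (lt_le_trans tx xb))// [f a + _]addrC subrK -kE ?subr_gt0//.
    by rewrite !mulrA mulfV ?mul1r// gt_eqF.
  have iKo : lebesgue_measure.-integrable `[a, x[ (EFin \o K).
    by apply: integrableS iK => //; apply: subset_itvl; rewrite bnd_simp.
  have mE : measurable_fun `[a, x[ (fun t => E1 ((x - t) / alpha) * f t).
    apply: (eq_measurable_fun (fun t => alpha * K t)) => [t|].
      by rewrite inE/= => tax; exact: EK.
    apply: measurable_funM; first exact: measurable_cst.
    by apply/measurable_EFinP; exact: measurable_int iKo.
  rewrite /frac_int /Rintegral -integral_itv_bndo_bndc; last exact/measurable_EFinP.
  rewrite -[X in _ * X]/(\int[lebesgue_measure]_(t in `[a, x[)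
    (E1 ((x - t) / alpha) * f t)).
  transitivity (alpha^-1 * \int[lebesgue_measure]_(t in `[a, x[) (alpha * K t)).
    by congr (_ * _); apply: eq_Rintegral => t; rewrite inE/= => tax; rewrite EK.
  rewrite RintegralZl// mulrA mulVf ?mul1r ?gt_eqF//.
  by rewrite Rintegral_itv_bndo_bndc.
have Fac : abs_continuous a b F by exact: (integral_abs_continuous iw).
have Frep : is_AC_rep a b (frac_int alpha a f) F.
  split => //; apply: aeW => x; rewrite in_itv/=; exact: JF.
have Hrep : is_AC_rep a b (frac_int alpha a f) (AC_rep a b (frac_int alpha a f)).
  by apply: xgetPex; exists F.
set H := AC_rep a b (frac_int alpha a f) in Hrep *.
(* [H] is whichever representative was chosen; agreement with [F] on [[a, b]] makes it a primitive
   of [w] there. *)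
have HF := is_AC_rep_unique ab Hrep Frep.
have Fa : F a = 0 by rewrite /F set_itv1 Rintegral_set1.
have Hw : {ae @lebesgue_measure R, forall x, a < x < b ->
    derivable H x 1 /\ derive1 H x = w x}.
  apply: ae_derive_integral => // x axb.
  by rewrite !HF ?lexx// Fa subr0.
have fw : {ae @lebesgue_measure R, forall x, a < x < b ->
    derivable f x 1 /\ derive1 f x = g x}.
  by apply: ae_derive_integral => // x axb; rewrite gE.
have ae_oo (c d : R) : {ae @lebesgue_measure R, forall x, x \in `[c, d] -> c < x < d}.
  apply: filterS2 (ae_ne c) (ae_ne d);
    first exact: (ae_filter_ringOfSetsType lebesgue_measure).
  by move=> x xc xd; rewrite in_itv/= !lt_neqAle eq_sym xc xd.
split.
  split; last first.
  - apply: filterS2 Hw (ae_oo a b);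
      first exact: (ae_filter_ringOfSetsType lebesgue_measure).
    by move=> x Hx xoo /xoo/Hx[].
  - by exists F.
  - have ifc := continuous_compact_integrable (@segment_compact R a b)
      (continuous_subspaceT cfc).
    apply: eq_integrable ifc => // x; rewrite inE/= in_itv/= => axb.
    by rewrite -fcE.
have iconv := ae_integrable_convolution ik ig.
apply: filterS3 Hw iconv (ae_oo a b);
  first exact: (ae_filter_ringOfSetsType lebesgue_measure).
move=> x Hx ikg xoo /xoo axb; have /andP[ax xltb] := axb.
pose kg y := k (x - y) * g y.
have reflE (y : R) : (k (x - y) * g (x - (x - y)))%:E = (kg y)%:E.
  by rewrite /kg; congr (_ * g _)%:E; ring.
have ikgx : lebesgue_measure.-integrable setT (EFin \o kg).
  by apply: eq_integrable (integrable_reflect x ikg) => // y _; exact: reflE.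
(* Substitution u = x - y; outside [[a, x]] one of the two factors vanishes. *)
have convE : \int[lebesgue_measure]_(y in `[a, x]) kg y = convolution k g x.
  rewrite Rintegral_mkcond /convolution /Rintegral -(integral_reflect x ikg).
  congr fine; apply: eq_integral => y _; rewrite reflE patchE mem_setE in_itv/=.
  case: ifPn => //; rewrite negb_and -!ltNge => /orP[ya|xy]; rewrite /kg.
    by rewrite g_lt ?mulr0.
  by rewrite k_le ?mul0r// subr_le0 ltW.
pose D y := alpha^-1 * E1 ((x - y) / alpha) * derive1 f y.
have mD : measurable_fun `[a, x] D.
  (* Measurability is checked on []a, x[]: at y = x the value of [E1] is arbitrary, and at y = a
     [derive1 f] depends on values of [f] to the left of [a], where [fc] may differ. *)
  apply: (@measurable_fun_itv_cc _ a x false true).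
  apply: (eq_measurable_fun (fun y : R => k (x - y) * derive1 fc y)) => [y|].
    rewrite inE/= in_itv/= => /andP[ay yx]; rewrite /D kE ?subr_gt0//.
    congr (_ * _); rewrite !derive1E; apply: near_eq_derive; near=> z.
    rewrite fcE//; apply/andP; split; apply: ltW; near: z; first exact: lt_nbhsr.
    by apply: lt_nbhsl; exact: lt_trans xltb.
  apply: measurable_funTS; apply: measurable_funM; first exact: mkx.
  exact: measurable_derive1.
have kgD : {ae @lebesgue_measure R, forall y, y \in `[a, x] -> kg y = D y}.
  apply: filterS2 fw (ae_oo a x);
    first exact: (ae_filter_ringOfSetsType lebesgue_measure).
  move=> y fy yoo /yoo/andP[ay yx].
  have [|_ fgy] := fy; first by rewrite ay (lt_trans yx).
  by rewrite /D fgy kE// subr_gt0.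
have ikgax : lebesgue_measure.-integrable `[a, x] (EFin \o kg).
  exact: integrableS ikgx.
have [iD DE] := ae_eq_integrable_Rintegral (measurable_itv `[a, x]) mD ikgax kgD.
split; first exact: iD.
rewrite /frac_deriv -/H (Hx axb).2 /w -convE kE ?subr_gt0//.
by rewrite -DE.
Unshelve. all: by end_near. Qed.
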